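(* Let $X$ be a real Hilbert space, let $U$ and $V$ be closed linear subspaces of $X$, let $T = P_V(2P_U-\mathrm{Id})+\mathrm{Id}-P_U$ be the associated Douglas--Rachford operator, and let $c_F$ be the cosine of the Friedrichs angle between $U$ and $V$. Let $n\in\mathbb{N}=\{0,1,2,\ldots\}$ and let $x\in X$. Then the following hold: (i) $\|P_UT^n-P_{U\cap V}\| = \|P_VT^n-P_{U\cap V}\| = c_F^n$. (ii) $\max\{\|P_UT^nx-P_{U\cap V}x\|,\ \|P_VT^nx-P_{U\cap V}x\|\}\le c_F^n\|x\|$. (iii) $\|P_VT^{n+1}x-P_{U\cap V}x\|\le c_F\|P_UT^nx-P_{U\cap V}x\|\le c_F\|T^nx-P_{\mathrm{Fix}\,T}x\|\le c_F^{n+1}\|x\|$.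
   Context: $X$ is a real Hilbert space (possibly infinite-dimensional) with inner product $\langle\cdot,\cdot\rangle$ and induced norm $\|\cdot\|$; for bounded linear operators, $\|\cdot\|$ is the operator norm. For a closed subspace $W$ of $X$, $P_W$ is the orthogonal projection onto $W$ and $W^\perp$ is its orthogonal complement. $\mathrm{Id}$ is the identity operator on $X$, and $T^n$ is the $n$-th power of $T$, with $T^0=\mathrm{Id}$. $\mathrm{Fix}\,T=\{x\in X : Tx=x\}$, which is a closed subspace. The cosine of the Friedrichs angle between $U$ and $V$ is $$c_F = c_F(U,V) := \sup\{\langle u,v\rangle : u\in U\cap(U\cap V)^\perp,\ v\in V\cap(U\cap V)^\perp,\ \|u\|\le 1,\ \|v\|\le 1\}.$$
   Formalization: In (i), the case n = 0 is asserted only when neither of U, V contains the other: if U ⊆ V (or V ⊆ U), then P_U − P_{U∩V} (resp. P_V − P_{U∩V}) is 0, while c_F^0 = 1, so (i) fails there. *)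

(* Defs.v *)
From HB Require Import structures.
From mathcomp Require Import all_boot all_order all_algebra.
From mathcomp Require Import all_classical all_reals all_analysis.
Set Implicit Arguments.
Unset Strict Implicit.
Unset Printing Implicit Defensive.
Import Order.TTheory GRing.Theory Num.Theory.
Import numFieldNormedType.Exports.
Local Open Scope classical_set_scope.
Local Open Scope ring_scope.

Section HilbertSubspaces.
Variables (R : realType) (X : completeNormedModType R).

(* A real inner product is a positive definite [{dot X for idfun}]; a complete
   normed module whose norm is induced by one is a real Hilbert space. *)
Definition induces_norm (ip : {dot X for idfun}) : Prop :=
  forall x : X, `|x| = Num.sqrt (ip x x).

Definition closed_subspace (W : set X) : Prop :=
  submod_closed (mem W) /\ closed W.

Definition orthocompl (ip : {dot X for idfun}) (W : set X) : set X :=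
  [set x | forall w, W w -> ip x w = 0].

(* The p in W with x - p orthogonal to W.  It exists and is unique when W is a
   closed subspace of a Hilbert space; the default value 0 is used otherwise. *)
Definition oproj (ip : {dot X for idfun}) (W : set X) (x : X) : X :=
  xget 0 [set p | W p /\ orthocompl ip W (x - p)].

Definition fixed_points (T : X -> X) : set X := [set x | T x = x].

(* [sup] is the real supremum, so this is the operator norm for bounded
   linear A only. *)
Definition opnorm (A : X -> X) : R :=
  sup [set `|A x| | x in [set x : X | `|x| <= 1]].

Definition friedrichs_cos (ip : {dot X for idfun}) (U V : set X) : R :=
  sup [set r | exists u v : X,
    [/\ (U `&` orthocompl ip (U `&` V)) u, (V `&` orthocompl ip (U `&` V)) v,
        `|u| <= 1, `|v| <= 1 & r = ip u v]].

Definition douglas_rachford (ip : {dot X for idfun}) (U V : set X) (x : X) : X :=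
  oproj ip V (2 *: oproj ip U x - x) + x - oproj ip U x.

End HilbertSubspaces.

(* Main.v *)
(** Write P, Q for the projections onto U, V.  Then
    T = QP + (1 - Q)(1 - P) has adjoint T* = PQ + (1 - P)(1 - Q), the
    Douglas-Rachford operator of (V, U), and
    |Tx|^2 = |x|^2 - |Px - Qx|^2 is symmetric in U and V, so T is normal.

    Upper bounds: Fix T contains U `&` V and the common part of the two
    orthogonal complements.  On z orthogonal to both, |Tz| <= c_F |z|,
    because the orthogonal summands QPz and (1 - Q)(1 - P)z are controlled by
    the Friedrichs angles of (U, V) and of the complements, and the latter is
    at most the former.  Moreover P and Q both send P_Fix x to P_(U `&` V) x.

    Lower bounds: by normality k |-> |T*^k w| is log-convex, hence
    |T*^n w| >= |T* w|^n for |w| <= 1 and n > 0.  If w lies in U (or V), is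
    orthogonal to U `&` V and |w| <= 1, then testing the operator on T*^n w
    shows that its norm is at least |T*^n w|, and |T* w| is |Qw| (or |Pw|),
    whose supremum is c_F. *)
Require Import Defs.
From HB Require Import structures.
From mathcomp Require Import all_boot all_order all_algebra.
From mathcomp Require Import all_classical all_reals all_analysis.
From mathcomp Require Import ring lra.
Import Order.TTheory GRing.Theory Num.Theory.
Import numFieldNormedType.Exports.
Local Open Scope classical_set_scope.
Local Open Scope ring_scope.

Section Hilbert.
Set Implicit Arguments.
Unset Strict Implicit.
Variables (R : realType) (X : completeNormedModType R).
Variables (ip : {dot X for idfun}) (ip_norm : induces_norm ip).
Implicit Types (x y z u v w : X) (W U V : set X).

Local Notation "''[' x , y ]" := (ip x y).
Local Notation "W ^_|_" := (orthocompl ip W).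
Local Notation P := (oproj ip).
Local Notation T := (douglas_rachford ip).

(** * Hilbert spaces and orthogonal projections *)

Lemma ip0l x : '[0, x] = 0.
Proof. exact: linear0l. Qed.

Lemma ip0r x : '[x, 0] = 0.
Proof. exact: linear0r. Qed.

Lemma ipNl x y : '[- x, y] = - '[x, y].
Proof. exact: linearNl. Qed.

Lemma ipNr x y : '[x, - y] = - '[x, y].
Proof. exact: linearNr. Qed.

Lemma ipDl x y z : '[x + y, z] = '[x, z] + '[y, z].
Proof. exact: linearDl. Qed.

Lemma ipDr x y z : '[x, y + z] = '[x, y] + '[x, z].
Proof. exact: linearDr. Qed.

Lemma ipBl x y z : '[x - y, z] = '[x, z] - '[y, z].
Proof. exact: linearBl. Qed.

Lemma ipBr x y z : '[x, y - z] = '[x, y] - '[x, z].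
Proof. exact: linearBr. Qed.

Lemma ipZl (a : R) x y : '[a *: x, y] = a * '[x, y].
Proof. exact: linearZl_LR. Qed.

Lemma ipZr (a : R) x y : '[x, a *: y] = a * '[x, y].
Proof. exact: linearZr_LR. Qed.

Let ipE := (ip0l, ip0r, ipNl, ipNr, ipDl, ipDr, ipBl, ipBr, ipZl, ipZr).

Lemma ipC x y : '[x, y] = '[y, x].
Proof. by rewrite hermC expr0 mul1r. Qed.

Lemma ip_ge0 x : 0 <= '[x, x].
Proof. by have [->|/neq0_dnorm_gt0/ltW] := eqVneq x 0; rewrite ?ip0l. Qed.

Lemma sqr_norm_ip x : `|x| ^+ 2 = '[x, x].
Proof. by rewrite ip_norm sqr_sqrtr ?ip_ge0. Qed.

(** Cauchy-Schwarz, by expanding the squared norm of |y| x - |x| y. *)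
Lemma ip_le_norm x y : '[x, y] <= `|x| * `|y|.
Proof.
have [->|x0] := eqVneq x 0; first by rewrite ip0l normr0 mul0r.
have [->|y0] := eqVneq y 0; first by rewrite ip0r normr0 mulr0.
have : 0 <= `| `|y| *: x - `|x| *: y | ^+ 2 by rewrite exprn_ge0.
rewrite sqr_norm_ip !ipE /=. rewrite (ipC y x) -!sqr_norm_ip.
have : 0 < `|x| * `|y| by rewrite mulr_gt0 ?normr_gt0.
by set a := `|x|; set b := `|y| => ab0 h; rewrite -(ler_pM2l ab0); nra.
Qed.

Lemma abs_ip_le_norm x y : `|'[x, y]| <= `|x| * `|y|.
Proof.
rewrite ler_norml ip_le_norm andbT lerNl -ipNl.
by rewrite -(normrN x) ip_le_norm.
Qed.

Lemma closureP W x :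
  closure W x <-> forall e : R, 0 < e -> exists2 w, W w & `|x - w| < e.
Proof.
split=> [xW e e0|xW B /nbhs_ballP[e /= e0 eB]].
  have [w [Ww]] := xW _ (nbhsx_ballx x e e0).
  by rewrite -ball_normE; exists w.
have [w Ww xw] := xW _ e0.
by exists w; split=> //; apply: eB; rewrite -ball_normE.
Qed.

Lemma subspaceP W : submod_closed (mem W) <->
  W 0 /\ forall (a : R) x y, W x -> W y -> W (a *: x + y).
Proof.
split=> [[W0 Wl]|[W0 Wl]]; split.
- by move: W0; rewrite inE.
- by move=> a x y Wx Wy; have := Wl a x y; rewrite !inE; apply.
- by rewrite inE.
- by move=> a x y; rewrite !inE; apply: Wl.
Qed.

(** * Projection onto a closed subspace *)

Section Subspace.
Variables (W : set X) (hW : closed_subspace W).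

Lemma subspace0 : W 0. Proof. by have [/subspaceP[]] := hW. Qed.

Lemma subspaceZD a x y : W x -> W y -> W (a *: x + y).
Proof. by have [/subspaceP[_ +] _] := hW; apply. Qed.

Lemma subspaceZ a x : W x -> W (a *: x).
Proof. by move=> Wx; rewrite -[a *: x]addr0; apply/subspaceZD/subspace0. Qed.

Lemma subspaceD x y : W x -> W y -> W (x + y).
Proof. by move=> Wx Wy; rewrite -(scale1r x); apply: subspaceZD. Qed.

Lemma subspaceB x y : W x -> W y -> W (x - y).
Proof. by move=> Wx Wy; rewrite addrC -scaleN1r; apply: subspaceZD. Qed.

Lemma subspace_limit x :
  (forall e : R, 0 < e -> exists2 w, W w & `|x - w| < e) -> W x.
Proof. by move=> xW; have [_] := hW; apply; apply/closureP. Qed.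

(* Compare with the competitor [w + t *: v] at the optimal [t]. *)
Lemma almost_minimizer_orth x w v d e : 0 <= e ->
  (forall y, W y -> d <= `|x - y| ^+ 2) ->
  W w -> `|x - w| ^+ 2 <= d + e ^+ 2 -> W v ->
  `|'[x - w, v]| <= e * `|v|.
Proof.
move=> e0 dmin Ww xw Wv.
have [->|v0] := eqVneq v 0; first by rewrite ip0r !normr0 mulr0.
have v2 : 0 < `|v| ^+ 2 by rewrite exprn_gt0 ?normr_gt0.
rewrite -ler_sqr ?nnegrE ?mulr_ge0 // real_normK ?num_real // exprMn.
have := dmin _ (subspaceZD ('[x - w, v] / `|v| ^+ 2) Wv Ww).
rewrite [_ + w]addrC opprD addrA sqr_norm_ip.
move: xw; rewrite sqr_norm_ip; move: (x - w) => y yd.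
rewrite !ipE (ipC v y) -(sqr_norm_ip v) => dy.
set t := _ / _ in dy; have tE : '[y, v] = t * `|v| ^+ 2.
  by rewrite /t divfK ?gt_eqF.
have tle : t * '[y, v] <= e ^+ 2 by rewrite tE in dy *; lra.
have -> : '[y, v] ^+ 2 = t * '[y, v] * `|v| ^+ 2 by rewrite tE; ring.
by rewrite ler_pM2r.
Qed.

(** Parallelogram law: the midpoint of [v] and [w] lies in [W], so |v - w|^2 = 2|x - v|^2 + 2|x -
    w|^2 - 4|x - (v + w)/2|^2 <= 4e^2. *)
Lemma almost_minimizers_close x v w d e : 0 <= e ->
  (forall y, W y -> d <= `|x - y| ^+ 2) -> W v -> W w ->
  `|x - v| ^+ 2 <= d + e ^+ 2 -> `|x - w| ^+ 2 <= d + e ^+ 2 ->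
  `|v - w| <= 2 * e.
Proof.
move=> e0 dmin Wv Ww xv xw.
rewrite -ler_sqr ?nnegrE ?mulr_ge0 //.
have := dmin _ (subspaceZ 2^-1 (subspaceD Wv Ww)).
move: xv xw; rewrite !sqr_norm_ip !ipE /=.
rewrite (ipC v x) (ipC w x) (ipC w v); lra.
Qed.

(** A minimizing sequence for the distance to [W] is Cauchy; its limit lies in [W], and the
    approximate orthogonality of its terms becomes exact there. *)
Lemma projection_exists x : exists p, W p /\ W^_|_ (x - p).
Proof.
pose E := [set `|x - w| ^+ 2 | w in W].
have infE : has_inf E.
  split; first by exists (`|x - 0| ^+ 2); exists 0 => //; exact: subspace0.
  by exists 0 => _ [w _ <-]; rewrite exprn_ge0.
pose d := inf E.
have dmin w : W w -> d <= `|x - w| ^+ 2.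
  by move=> Ww; apply: ge_inf; [case: infE|exists w].
have hu (k : nat) : exists w, W w /\ `|x - w| ^+ 2 <= d + (k.+1%:R^-1) ^+ 2.
  have k0 : 0 < (k.+1%:R^-1) ^+ 2 :> R by rewrite exprn_gt0 ?invr_gt0.
  have [_ [w Ww <-] /ltW wd] := inf_adherent k0 infE.
  by exists w.
have [u uW] := choice hu.
have small (e : R) : 0 < e ->
    exists N, forall k : nat, (N <= k)%N -> k.+1%:R^-1 < e.
  move=> e0; exists (Num.truncn e^-1) => k Nk.
  rewrite invf_plt ?posrE //; apply: lt_le_trans (truncnS_gt _) _.
  by rewrite ler_nat ltnS.
have ucvg : cvg (u @ \oo).
  apply: cauchy_cvg; apply: cauchy_exP => e e0.
  have [N hN] := small (e / 2) ltac:(by rewrite divr_gt0).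
  exists (u N); exists N => // k /= Nk; rewrite -ball_normE /=.
  apply: (@le_lt_trans _ _ (2 * N.+1%:R^-1)); last first.
    by rewrite mulrC -ltr_pdivlMr //; apply: hN.
  apply: (almost_minimizers_close _ dmin (uW N).1 (uW k).1 (uW N).2).
    by rewrite invr_ge0.
  apply: le_trans (uW k).2 _; rewrite lerD2l ler_sqr ?nnegrE ?invr_ge0 //.
  by rewrite lef_pV2 ?posrE // ler_nat ltnS.
set p := lim (u @ \oo).
have pu (e : R) : 0 < e -> exists k, `|p - u k| < e /\ k.+1%:R^-1 < e.
  move=> e0; have [N hN] := small _ e0.
  have /cvgrPdist_lt/(_ _ e0)[M _ hM] : u @ \oo --> p by [].
  exists (maxn M N); split; first by apply: hM; rewrite /= leq_maxl.
  by apply: hN; rewrite leq_maxr.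
exists p; split.
  apply: subspace_limit => e /pu[k [pk _]].
  by exists (u k) => //; case: (uW k).
(* Split x - p at a term [u k]: both contributions are at most e/2, by almost minimality of [u k]
   and by Cauchy-Schwarz. Dividing by |w| + 1 covers w = 0. *)
move=> w Ww; apply/eqP; rewrite -normr_le0; apply/ler_addgt0Pr => e e0.
rewrite add0r.
have w0 : 0 < `|w| + 1 by rewrite ltr_wpDl.
have [k [pk ke]] := pu (e / 2 / (`|w| + 1)) ltac:(by rewrite !divr_gt0).
have -> : x - p = (x - u k) + (u k - p) by rewrite addrA subrK.
rewrite ipDl; apply: le_trans (ler_normD _ _) _.
have [Wu xu] := uW k.
have k0 : 0 <= k.+1%:R^-1 :> R by rewrite invr_ge0.
have h1 := almost_minimizer_orth k0 dmin Wu xu Ww.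
have h2 := abs_ip_le_norm (u k - p) w.
rewrite distrC in h2.
move: pk ke; rewrite !ltr_pdivlMr //.
have := normr_ge0 w; have := normr_ge0 (p - u k).
by move: (k.+1%:R^-1 : R) k0 h1 => c c0 h1; lra.
Qed.

Lemma ip_eq0 x : '[x, x] = 0 -> x = 0.
Proof. by rewrite -sqr_norm_ip => /eqP; rewrite expf_eq0 normr_eq0 => /eqP. Qed.

(* Turns identities between vectors into scalar ones, which [ring] can solve. *)
Lemma ip_ext x y : (forall z, '[x, z] = '[y, z]) -> x = y.
Proof.
by move=> xy; apply/subr0_eq/ip_eq0; rewrite ipBl xy subrr.
Qed.

Lemma oprojP x : W (P W x) /\ W^_|_ (x - P W x).
Proof. exact: (xgetPex 0 (projection_exists x)). Qed.

Lemma oproj_in x : W (P W x). Proof. by case: (oprojP x). Qed.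

Lemma oproj_ip x w : W w -> '[P W x, w] = '[x, w].
Proof.
by case: (oprojP x) => _ xW Ww; apply/esym/subr0_eq; rewrite -ipBl xW.
Qed.

Lemma oproj_eq x p : W p -> W^_|_ (x - p) -> P W x = p.
Proof.
move=> Wp xp; apply/subr0_eq/ip_eq0; set d := _ - p.
have Wd : W d by apply: subspaceB => //; exact: oproj_in.
by have := xp d Wd; rewrite /d !ipBl oproj_ip.
Qed.

Lemma oproj_id x : W x -> P W x = x.
Proof. by move=> Wx; apply: oproj_eq => // w _; rewrite subrr ip0l. Qed.

Lemma oproj_sym x y : '[P W x, y] = '[x, P W y].
Proof.
transitivity '[P W x, P W y]; last exact: oproj_ip (oproj_in y).
by rewrite ipC -(oproj_ip y (oproj_in x)) ipC.
Qed.

Lemma oprojZD a x y : P W (a *: x + y) = a *: P W x + P W y.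
Proof. by apply: ip_ext => z; rewrite !(ipE, oproj_sym). Qed.

Lemma oprojB x y : P W (x - y) = P W x - P W y.
Proof. by apply: ip_ext => z; rewrite !(ipE, oproj_sym). Qed.

Lemma oprojZ a x : P W (a *: x) = a *: P W x.
Proof. by apply: ip_ext => z; rewrite !(ipE, oproj_sym). Qed.

Lemma sqr_norm_oprojB x : `|x - P W x| ^+ 2 = `|x| ^+ 2 - `|P W x| ^+ 2.
Proof.
rewrite !sqr_norm_ip !ipE (ipC _ x).
by rewrite oproj_ip; [ring | exact: oproj_in].
Qed.

Lemma norm_oproj_le x : `|P W x| <= `|x|.
Proof.
rewrite -ler_sqr ?nnegrE //; have := sqr_norm_oprojB x.
by have := exprn_ge0 2 (normr_ge0 (x - P W x)); lra.
Qed.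

Lemma norm_oprojB_le x : `|x - P W x| <= `|x|.
Proof.
rewrite -ler_sqr ?nnegrE // sqr_norm_oprojB.
by have := exprn_ge0 2 (normr_ge0 (P W x)); lra.
Qed.

End Subspace.

(** * Constructions of closed subspaces *)

Lemma closed_subspaceI U V : closed_subspace U -> closed_subspace V ->
  closed_subspace (U `&` V).
Proof.
move=> hU hV; split; last by apply: closedI; [case: hU|case: hV].
apply/subspaceP; split; first by split; apply: subspace0.
by move=> a x y [Ux Vx] [Uy Vy]; split; apply: subspaceZD.
Qed.

Lemma closed_subspace_closure W : submod_closed (mem W) ->
  closed_subspace (closure W).
Proof.
move=> /subspaceP[W0 Wl]; split; last exact: closed_closure.
apply/subspaceP; split; first exact: subset_closure.
move=> a x y /closureP xW /closureP yW; apply/closureP => e e0.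
have a0 : 0 < `|a| + 1 by rewrite ltr_wpDl.
have [x' Wx' xx'] := xW (e / 2 / (`|a| + 1)) ltac:(by rewrite !divr_gt0).
have [y' Wy' yy'] := yW (e / 2) ltac:(by rewrite divr_gt0).
exists (a *: x' + y'); first exact: Wl.
rewrite opprD addrACA -scalerBr; apply: le_lt_trans (ler_normD _ _) _.
rewrite normrZ; move: xx' yy'; rewrite !ltr_pdivlMr //.
by have := normr_ge0 (x - x'); have := normr_ge0 a; nra.
Qed.

Lemma ip_closure0 W x w : closure W x -> (forall v, W v -> '[v, w] = 0) ->
  '[x, w] = 0.
Proof.
move=> /closureP xW Ww; apply/eqP; rewrite -normr_le0.
apply/ler_addgt0Pr => e e0; have w0 : 0 < `|w| + 1 by rewrite ltr_wpDl.
have [v Wv xv] := xW (e / (`|w| + 1)) ltac:(by rewrite divr_gt0).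
rewrite -[x](subrK v) ipDl (Ww v Wv) addr0 add0r.
apply: le_trans (abs_ip_le_norm _ _) _; move: xv; rewrite ltr_pdivlMr //.
by have := normr_ge0 (x - v); nra.
Qed.

Lemma closed_subspace_orthocompl W : closed_subspace (W^_|_).
Proof.
split.
  apply/subspaceP; split=> [w _|a x y xW yW w Ww]; first by rewrite ip0l.
  by rewrite !ipE (xW w Ww) (yW w Ww) mulr0 addr0.
by move=> x xW w Ww; apply: ip_closure0 xW _ => v; apply.
Qed.

(** * The Douglas-Rachford operator *)

Section DouglasRachford.
Variables (U V : set X) (hU : closed_subspace U) (hV : closed_subspace V).

(** The first summand lies in [V], the second in its orthogonal complement. *)
Lemma drE x : T U V x = P V (P U x) + ((x - P U x) - P V (x - P U x)).
Proof.
apply: ip_ext => z; rewrite /douglas_rachford !(oprojB hV) (oprojZ hV) !ipE.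
by ring.
Qed.

Lemma drZD a x y : T U V (a *: x + y) = a *: T U V x + T U V y.
Proof.
apply: ip_ext => z; rewrite !drE !(ipE, oproj_sym hV, oproj_sym hU).
by ring.
Qed.

Lemma oproj_dr x : P V (T U V x) = P V (P U x).
Proof.
apply: ip_ext => z; rewrite (oproj_sym hV) drE !(ipE, oproj_sym hV).
by rewrite !(oproj_id hV (oproj_in hV _)); ring.
Qed.

Lemma sqr_norm_dr x : `|T U V x| ^+ 2 = `|x| ^+ 2 - `|P U x - P V x| ^+ 2.
Proof.
(* These relations between the inner products of [x], [P U x], [P V x] and [P V (P U x)] make the
   claim linear, within reach of [lra]. *)
have aE := oproj_ip hU x (oproj_in hU x).
have bE := oproj_ip hV x (oproj_in hV x).
have eE := oproj_ip hV (P U x) (oproj_in hV (P U x)).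
have ebE := oproj_ip hV (P U x) (oproj_in hV x).
have exE := oproj_sym hV (P U x) x.
rewrite !sqr_norm_ip /douglas_rachford !(oprojB hV) (oprojZ hV) !ipE.
have := ipC x (P U x); have := ipC x (P V x); have := ipC x (P V (P U x)).
have := ipC (P U x) (P V x).
by have := ipC (P V (P U x)) (P U x); have := ipC (P V (P U x)) (P V x); lra.
Qed.

Lemma iter_drZD n a x y :
  iter n (T U V) (a *: x + y) = a *: iter n (T U V) x + iter n (T U V) y.
Proof. by elim: n => // n IHn; rewrite !iterS IHn drZD. Qed.

Lemma dr_fixed_inter w : U w -> V w -> T U V w = w.
Proof.
move=> Uw Vw; rewrite drE (oproj_id hU) // subrr (oproj_id hV) //.
by rewrite (oproj_id hV) ?subrr ?addr0 //; exact: subspace0.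
Qed.

Lemma dr_fixed_orthocompl w : U^_|_ w -> V^_|_ w -> T U V w = w.
Proof.
move=> Uw Vw; have P0 W : closed_subspace W -> W^_|_ w -> P W w = 0.
  by move=> hW Ww; apply: oproj_eq => //; rewrite ?subr0 //; exact: subspace0.
rewrite drE (P0 U) // subr0 (P0 V) // subr0 (oproj_id hV) ?add0r //.
exact: subspace0.
Qed.

(** Since P V f = P V (T f) = P V (P U f), the fixed-point equation in the form [drE] reduces to P U
    f = P V (P U f), which puts P U f in [V] too. *)
Lemma fixed_dr_oproj f : T U V f = f ->
  (U `&` V) (P U f) /\ P V f = P U f.
Proof.
move=> Tf; have PVf : P V f = P V (P U f) by rewrite -oproj_dr Tf.
have PUf : P U f = P V (P U f).
  apply: ip_ext => z; have /(congr1 (ip^~ z)) := drE f.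
  by rewrite Tf (oprojB hV) PVf !ipE; lra.
rewrite PVf -PUf; split=> //; split; first exact: oproj_in.
by rewrite PUf; exact: oproj_in.
Qed.

Lemma closed_subspace_fixed_dr : closed_subspace (fixed_points (T U V)).
Proof.
have T0 : T U V 0 = 0 by apply: dr_fixed_inter; exact: subspace0.
have TB x y : T U V (x - y) = T U V x - T U V y.
  by rewrite addrC -scaleN1r drZD scaleN1r addrC.
split.
  apply/subspaceP; split=> // a x y; rewrite /fixed_points /= => Tx Ty.
  by rewrite drZD Tx Ty.
move=> x /closureP xF; apply/eqP; rewrite -subr_eq0 -normr_le0.
apply/ler_addgt0Pr => e e0; rewrite add0r.
have [w Tw xw] := xF (e / 2) ltac:(by rewrite divr_gt0).
(* The norm identity makes the operator nonexpansive, so limits of fixed points are fixed. *)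
have Twx : `|T U V (x - w)| <= `|x - w|.
  rewrite -ler_sqr ?nnegrE // sqr_norm_dr.
  by have := exprn_ge0 2 (normr_ge0 (P U (x - w) - P V (x - w))); lra.
have -> : T U V x - x = T U V (x - w) - (x - w).
  by rewrite TB Tw opprB addrA subrK.
by apply: le_trans (ler_normB _ _) _; lra.
Qed.

End DouglasRachford.

(** * Adjoint, normality and powers *)

Section Adjoint.
Variables (U V : set X) (hU : closed_subspace U) (hV : closed_subspace V).

Lemma dr_adjoint x y : '[T U V x, y] = '[x, T V U y].
Proof.
rewrite (drE U hV) (drE V hU) (oprojB hU) (oprojB hV).
by rewrite !(ipE, oproj_sym hV, oproj_sym hU); ring.
Qed.

Lemma iter_dr_adjoint n x y :
  '[iter n (T U V) x, y] = '[x, iter n (T V U) y].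
Proof.
by elim: n x y => // n IHn x y; rewrite iterS dr_adjoint IHn -iterSr.
Qed.

Lemma norm_dr_sym x : `|T U V x| = `|T V U x|.
Proof.
apply/eqP; rewrite -(@eqrXn2 _ 2) // !sqr_norm_dr //.
by rewrite (distrC (P U x)).
Qed.

(** With T = [T U V] and its adjoint S = [T V U], |S x|^2 = <T S x, x> <= |x| |T S x|, and |T S x| =
    |S S x| by normality. *)
Lemma sqr_norm_dr_le x : `|T V U x| ^+ 2 <= `|x| * `|T V U (T V U x)|.
Proof.
rewrite sqr_norm_ip -norm_dr_sym -dr_adjoint ipC.
exact: ip_le_norm.
Qed.

(** Exponents start at 1: for exponent 0 the bound would read 1 <= |x|. *)
Lemma norm_iter_dr_ge n x : `|x| <= 1 ->
  `|T V U x| ^+ n.+1 <= `|iter n.+1 (T V U) x|.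
Proof.
move=> x1; pose a k := `|iter k (T V U) x|.
have a0 k : 0 <= a k by rewrite /a.
have logconvex k : a k.+1 ^+ 2 <= a k * a k.+2 by exact: sqr_norm_dr_le.
(* Log-convexity makes the ratios of consecutive terms nondecreasing, and the first is at least
   [a 1] because [a 0] <= 1. If [a k] vanishes, so does the next term. *)
have step k : a 1%N * a k <= a k.+1.
  elim: k => [|k IHk]; first by rewrite ler_piMr.
  have := logconvex k; have := a0 k; rewrite le_eqVlt => /predU1P[<-|ak] h.
    have -> : a k.+1 = 0.
      apply/eqP; rewrite -sqrf_eq0 eq_le exprn_ge0 // andbT.
      by rewrite -[0](mul0r (a k.+2)).
    by rewrite mulr0.
  by rewrite -(ler_pM2l ak); have := a0 k.+1; nra.
elim: n => // n IHn; rewrite exprS; apply: le_trans (step n.+1).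
by rewrite ler_wpM2l.
Qed.

End Adjoint.

(** * The Friedrichs angle *)

Local Notation cF := (friedrichs_cos ip).

Lemma friedrichs_sym U V : cF U V = cF V U.
Proof.
rewrite /friedrichs_cos (setIC V U); congr sup; apply/seteqP.
by split=> _ [u [v [Uu Vv u1 v1 ->]]]; exists v, u; rewrite ipC.
Qed.

Section Friedrichs.
Variables (U V : set X) (hU : closed_subspace U) (hV : closed_subspace V).
Let E := [set r | exists u v : X,
    [/\ (U `&` (U `&` V)^_|_) u, (V `&` (U `&` V)^_|_) v,
        `|u| <= 1, `|v| <= 1 & r = '[u, v]]].

Let E0 : E 0.
Proof.
exists 0, 0; rewrite ip0l normr0 ler01; split=> //; split;
  by [exact: subspace0 | move=> w _; rewrite ip0l].
Qed.

Let E_ub1 : ubound E 1.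
Proof.
move=> _ [u [v [_ _ u1 v1 ->]]]; apply: le_trans (ip_le_norm u v) _.
by rewrite mulr_ile1.
Qed.

Lemma friedrichs_ge0 : 0 <= cF U V.
Proof. by apply: ub_le_sup => //; exists 1. Qed.

Lemma friedrichs_le1 : cF U V <= 1.
Proof. by apply: ge_sup => //; exists 0. Qed.

Lemma ip_le_friedrichs u v :
  U u -> (U `&` V)^_|_ u -> V v -> (U `&` V)^_|_ v ->
  '[u, v] <= cF U V * (`|u| * `|v|).
Proof.
move=> Uu uUV Vv vUV.
have [->|u0] := eqVneq u 0; first by rewrite ip0l normr0 mul0r mulr0.
have [->|v0] := eqVneq v 0; first by rewrite ip0r normr0 !mulr0.
have uv0 : 0 < `|u| * `|v| by rewrite mulr_gt0 ?normr_gt0.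
rewrite -ler_pdivrMr // invfM mulrC -mulrA -ipZr -ipZl.
apply: ub_le_sup; first by exists 1.
exists (`|u|^-1 *: u), (`|v|^-1 *: v); split.
- by split; [exact: subspaceZ | move=> w Ww; rewrite ipZl uUV // mulr0].
- by split; [exact: subspaceZ | move=> w Ww; rewrite ipZl vUV // mulr0].
- by rewrite normrZ normfV normr_id mulVf ?normr_eq0.
- by rewrite normrZ normfV normr_id mulVf ?normr_eq0.
- by [].
Qed.

(** Pair [u] with [P V u], which is again orthogonal to the intersection: |P V u|^2 = <u, P V u> <=
    c |u| |P V u|. *)
Lemma norm_oproj_friedrichs u : U u -> (U `&` V)^_|_ u ->
  `|P V u| <= cF U V * `|u|.
Proof.
move=> Uu uUV; have VPu := oproj_in hV u.
have [->|Pu0] := eqVneq (P V u) 0.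
  by rewrite normr0 mulr_ge0 // friedrichs_ge0.
have Pu : 0 < `|P V u| by rewrite normr_gt0.
rewrite -(ler_pM2r Pu) -mulrA -expr2 sqr_norm_ip (oproj_ip hV _ VPu).
apply: ip_le_friedrichs => // w [Uw Vw].
by rewrite (oproj_ip hV) // uUV.
Qed.

End Friedrichs.

(** * The angle between the orthogonal complements *)

Section Complement.
Variables (U V : set X) (hU : closed_subspace U) (hV : closed_subspace V).

(* Writing p = |P U v| and q = |P V (P U v)|, this is p^2 - q^2 <= c^2 (|v|^2 -
   p^2), which follows from p^2 <= q |v| and p <= c |v|. *)
Lemma norm_oprojB_friedrichs v : V v -> (U `&` V)^_|_ v ->
  `|(v - P U v) - P V (v - P U v)| <= cF U V * `|v - P U v|.
Proof.
move=> Vv vUV; have [->|v0] := eqVneq v 0.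
  rewrite (oproj_id hU (subspace0 hU)) subr0 (oproj_id hV (subspace0 hV)).
  by rewrite subr0 normr0 mulr0.
have v2 : 0 < `|v| ^+ 2 by rewrite exprn_gt0 ?normr_gt0.
have c0 := friedrichs_ge0 hU hV.
rewrite -ler_sqr ?nnegrE ?mulr_ge0 // exprMn (sqr_norm_oprojB hV).
(* As [v] is in [V], the vector (v - P U v) - P V (v - P U v) equals P V (P U v) - P U v. *)
have -> : `|v - P U v| ^+ 2 - `|P V (v - P U v)| ^+ 2 =
    `|P U v| ^+ 2 - `|P V (P U v)| ^+ 2.
  rewrite -!sqr_norm_oprojB // (oprojB hV) (oproj_id hV Vv).
  rewrite -normrN; congr (`|_| ^+ 2).
  by apply: ip_ext => t; rewrite !ipE; ring.
rewrite (sqr_norm_oprojB hU).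
have pq : `|P U v| ^+ 2 <= `|P V (P U v)| * `|v|.
  rewrite sqr_norm_ip (oproj_ip hU _ (oproj_in hU _)) ipC.
  by rewrite -{2}(oproj_id hV Vv) -(oproj_sym hV) ip_le_norm.
have pc : `|P U v| <= cF U V * `|v|.
  by rewrite friedrichs_sym norm_oproj_friedrichs // setIC.
have pv := norm_oproj_le hU v.
move: v2 c0 pq pc pv; move: `|v| (normr_ge0 v) `|P U v| (normr_ge0 (P U v)).
move: (cF U V) `|P V (P U v)| (normr_ge0 (P V (P U v))).
move=> c q q0 b b0 p p0 b2 c0 pq pc pb.
have q2 : (p ^+ 2) ^+ 2 <= q ^+ 2 * b ^+ 2.
  by rewrite -exprMn ler_sqr ?nnegrE ?mulr_ge0 ?exprn_ge0.
have p2 : p ^+ 2 <= c ^+ 2 * b ^+ 2.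
  by rewrite -exprMn ler_sqr ?nnegrE ?mulr_ge0.
have pb2 : p ^+ 2 <= b ^+ 2 by rewrite ler_sqr ?nnegrE.
(* Multiplied by b^2, the left side is at most p^2 (b^2 - p^2) by [q2]; then [p2] bounds p^2 by c^2
   b^2. *)
by rewrite -(ler_pM2r b2); nra.
Qed.

(* The vectors v - P U v of the previous lemma are dense among the z considered
   here. *)
Lemma norm_oprojB_orthocompl z : U^_|_ z -> (U^_|_ `&` V^_|_)^_|_ z ->
  `|z - P V z| <= cF U V * `|z|.
Proof.
move=> Uz zUV; have c0 := friedrichs_ge0 hU hV.
have hUV := closed_subspaceI hU hV.
pose A := [set v - P U v | v in V `&` (U `&` V)^_|_].
have hA : closed_subspace (closure A).
  have hV' := closed_subspaceI hV (closed_subspace_orthocompl (U `&` V)).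
  apply/closed_subspace_closure/subspaceP; split.
    exists 0; first exact: (subspace0 hV').
    by rewrite -[0]subr0 (oprojB hU) !subrr.
  move=> a _ _ [v V'v <-] [w V'w <-]; exists (a *: v + w).
    exact: (subspaceZD hV').
  by apply: ip_ext => y; rewrite (oprojZD hU) !ipE; ring.
have Ain v : V v -> (U `&` V)^_|_ v -> closure A (v - P U v).
  by move=> Vv vUV; apply: subset_closure; exists v.
set p := P (closure A) z; have Ap : closure A p by exact: oproj_in.
have Ud : U^_|_ (z - p).
  move=> u Uu; rewrite ipBl Uz // sub0r; apply/eqP; rewrite oppr_eq0; apply/eqP.
  apply: ip_closure0 Ap _ => _ [v _ <-].
  rewrite -(oproj_id hU Uu) -(oproj_sym hU) (oprojB hU).
  by rewrite (oproj_id hU (oproj_in hU v)) subrr ip0l.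
(* Removing from [v] its component [w] in the intersection makes v - w admissible in [A]; as z - p
   is orthogonal to [U], only <z - p, v> survives. *)
have Vd : V^_|_ (z - p).
  move=> v Vv; set w := P (U `&` V) v.
  have [Uw Vw] : (U `&` V) w by exact: oproj_in.
  have /(oproj_ip hA z) /eqP : closure A ((v - w) - P U (v - w)).
    apply: Ain; first exact: subspaceB.
    by move=> y Wy; rewrite ipBl (oproj_ip hUV) // subrr.
  rewrite eq_sym -subr_eq0 -ipBl -/p => /eqP.
  rewrite ipBr (Ud _ (oproj_in hU _)) subr0.
  by rewrite ipBr (Ud _ Uw) subr0.
(* z - p lies in both complements, hence is orthogonal to z by hypothesis, and to every v - P U v,
   so to p. *)
have zp : z = p.
  apply/subr0_eq/ip_eq0; rewrite ipBl zUV // sub0r; apply/eqP; rewrite oppr_eq0.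
  apply/eqP; apply: ip_closure0 Ap _ => _ [v [Vv _] <-].
  by rewrite ipC ipBr Vd // Ud ?subrr //; exact: oproj_in.
have /closureP zA : closure A z by rewrite zp.
(* Approximating z within e/2 costs at most (1 + c) e/2, and c <= 1. *)
apply/ler_addgt0Pr => e e0.
have [_ [v [Vv vUV] <-]] := zA (e / 2) ltac:(by rewrite divr_gt0).
set y := v - P U v => zy.
have yc : `|y - P V y| <= cF U V * `|y| by exact: norm_oprojB_friedrichs.
have dc := norm_oprojB_le hV (z - y).
have -> : z - P V z = (z - y - P V (z - y)) + (y - P V y).
  by apply: ip_ext => t; rewrite (oprojB hV) !ipE; ring.
apply: le_trans (ler_normD _ _) _.
have yz : `|y| <= `|z| + `|z - y|.
  by rewrite -{1}(subKr z y) ler_normB.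
have := friedrichs_le1 hU hV; have := normr_ge0 (z - y); nra.
Qed.

Lemma norm_dr_friedrichs z :
  (U `&` V)^_|_ z -> (U^_|_ `&` V^_|_)^_|_ z -> `|T U V z| <= cF U V * `|z|.
Proof.
move=> zUV zUV'; have c0 := friedrichs_ge0 hU hV.
have PUz := oproj_in hU z.
have h1 : `|P V (P U z)| <= cF U V * `|P U z|.
  apply: norm_oproj_friedrichs => // w [Uw Vw].
  by rewrite (oproj_ip hU) // zUV.
have Uz : U^_|_ (z - P U z) by case: (oprojP hU z).
have h2 : `|(z - P U z) - P V (z - P U z)| <= cF U V * `|z - P U z|.
  apply: norm_oprojB_orthocompl => // w UVw.
  by rewrite ipBl zUV' // ipC (UVw.1 _ PUz) subrr.
rewrite -ler_sqr ?nnegrE ?mulr_ge0 // (drE U hV) exprMn.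
have -> : `|P V (P U z) + (z - P U z - P V (z - P U z))| ^+ 2 =
    `|P V (P U z)| ^+ 2 + `|z - P U z - P V (z - P U z)| ^+ 2.
  have [_ /(_ _ (oproj_in hV (P U z)))] := oprojP hV (z - P U z).
  move: (_ - P V _) => y yV.
  by rewrite !sqr_norm_ip !(ipDl, ipDr) (ipC _ y) yV addr0 add0r.
have sqr_le (a b : X) : `|a| <= cF U V * `|b| ->
    `|a| ^+ 2 <= cF U V ^+ 2 * `|b| ^+ 2.
  by move=> ab; rewrite -exprMn ler_sqr ?nnegrE ?mulr_ge0.
have := sqr_norm_oprojB hU z; have := sqr_le _ _ h1; have := sqr_le _ _ h2.
by nra.
Qed.

End Complement.

(** * Iterates *)

(** The supremum is compared with the (n+1)-th root of [M], which is nonnegative and so dominates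
    negative inner products trivially. *)
Lemma friedrichs_exp_le U V n (M : R) : 0 <= M ->
  (forall u v, U u -> (U `&` V)^_|_ u -> V v -> (U `&` V)^_|_ v ->
     `|u| <= 1 -> `|v| <= 1 -> 0 <= '[u, v] -> '[u, v] ^+ n.+1 <= M) ->
  closed_subspace U -> closed_subspace V -> cF U V ^+ n.+1 <= M.
Proof.
move=> M0 hM hU hV; pose K := M `^ n.+1%:R^-1.
have K0 : 0 <= K by exact: powR_ge0.
have KM : K ^+ n.+1 = M.
  by rewrite -powR_mulrn // -powRrM mulVf ?powRr1 // pnatr_eq0.
rewrite -KM lerXn2r ?nnegrE ?friedrichs_ge0 //; apply: ge_sup.
  exists 0, 0, 0; rewrite ip0l normr0 ler01; split=> //; split;
    by [exact: subspace0 | move=> w _; rewrite ip0l].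
move=> _ [u [v [[Uu uUV] [Vv vUV] u1 v1 ->]]].
have [uv0|/ltW/le_trans->//] := leP 0 '[u, v].
by rewrite -(@ler_pXn2r _ n.+1) ?nnegrE // KM; exact: hM.
Qed.

Lemma norm_dr_in U V u : closed_subspace U -> closed_subspace V -> U u ->
  `|T U V u| = `|P V u|.
Proof.
move=> hU hV Uu; apply/eqP; rewrite -(@eqrXn2 _ 2) // sqr_norm_dr //.
by rewrite (oproj_id hU) // (sqr_norm_oprojB hV) subKr.
Qed.

Lemma ip_le_norm_oproj W u v : closed_subspace W -> W v -> `|v| <= 1 ->
  '[u, v] <= `|P W u|.
Proof.
move=> hW Wv v1; rewrite -(oproj_ip hW u Wv).
apply: le_trans (ip_le_norm _ _) _.
by rewrite ler_piMr.
Qed.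

Section Iterates.
Variables (U V : set X) (hU : closed_subspace U) (hV : closed_subspace V).
Local Notation PUV := (P (U `&` V)).
Local Notation PFix := (P (fixed_points (T U V))).
Let hUV := closed_subspaceI hU hV.
Let hFix := closed_subspace_fixed_dr hU hV.

(** Both projections of a fixed point are the same point of the intersection; it is the projection
    of [x] because the intersection consists of fixed points. *)
Lemma oproj_fixed x : P U (PFix x) = PUV x /\ P V (PFix x) = PUV x.
Proof.
have [UVf ->] := fixed_dr_oproj hU hV (oproj_in hFix x).
split; apply/esym/(oproj_eq hUV) => // w [Uw Vw].
all: rewrite ipBl (oproj_ip hU) // (oproj_ip hFix) ?subrr //.
all: exact: dr_fixed_inter.
Qed.

Lemma iter_dr_sub_oproj n x :
  iter n (T U V) x - PFix x = iter n (T U V) (x - PFix x).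
Proof.
rewrite -{1}[x](subrK (PFix x)) -{1}[x - _]scale1r iter_drZD // scale1r.
by rewrite (iter_fix _ (oproj_in hFix x)) addrK.
Qed.

Lemma norm_iter_dr_friedrichs n z :
  (U `&` V)^_|_ z -> (U^_|_ `&` V^_|_)^_|_ z ->
  `|iter n (T U V) z| <= cF U V ^+ n * `|z|.
Proof.
move=> zUV zUV'; elim: n => [|n IHn]; first by rewrite expr0 mul1r.
rewrite iterS exprS -mulrA.
apply: le_trans (ler_wpM2l (friedrichs_ge0 hU hV) IHn).
(* The adjoint fixes the intersection and the common complement pointwise, so the iterates stay
   orthogonal to both. *)
apply: norm_dr_friedrichs => // w [Uw Vw]; rewrite iter_dr_adjoint //.
  by rewrite iter_fix ?zUV //; exact: dr_fixed_inter.
by rewrite iter_fix ?zUV' //; exact: dr_fixed_orthocompl.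
Qed.

Lemma oprojB_fixed_orth x :
  (U `&` V)^_|_ (x - PFix x) /\ (U^_|_ `&` V^_|_)^_|_ (x - PFix x).
Proof.
split=> w [Uw Vw]; rewrite ipBl (oproj_ip hFix) ?subrr //.
  exact: dr_fixed_inter.
exact: dr_fixed_orthocompl.
Qed.

Lemma norm_iter_dr_sub_oproj n x :
  `|iter n (T U V) x - PFix x| <= cF U V ^+ n * `|x|.
Proof.
have [zUV zUV'] := oprojB_fixed_orth x.
rewrite iter_dr_sub_oproj.
apply: le_trans (norm_iter_dr_friedrichs n zUV zUV') _.
by rewrite ler_wpM2l ?exprn_ge0 ?friedrichs_ge0 // norm_oprojB_le.
Qed.

Lemma norm_oproj_iter_dr W n x : closed_subspace W -> P W (PFix x) = PUV x ->
  `|P W (iter n (T U V) x) - PUV x| <= `|iter n (T U V) x - PFix x|.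
Proof. by move=> hW <-; rewrite -(oprojB hW) norm_oproj_le. Qed.

(** By [oproj_dr], the left side is the norm of [P V] applied to the difference on the right, a
    vector of [U] orthogonal to the intersection. *)
Lemma norm_oproj_iter_drS n x :
  `|P V (iter n.+1 (T U V) x) - PUV x| <=
  cF U V * `|P U (iter n (T U V) x) - PUV x|.
Proof.
have UVx := oproj_in hUV x.
rewrite iterS oproj_dr // -{1}(oproj_id hV UVx.2) -(oprojB hV).
apply: norm_oproj_friedrichs => //.
  by apply: subspaceB => //; [exact: oproj_in | case: UVx].
move=> w [Uw Vw]; have [<- _] := oproj_fixed x.
have [zUV _] := oprojB_fixed_orth x.
rewrite -(oprojB hU) (oproj_ip hU) // iter_dr_sub_oproj iter_dr_adjoint //.
by rewrite iter_fix ?zUV //; exact: dr_fixed_inter.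
Qed.

(** * Operator norms, for [W] equal to [U] or [V] *)

Section OperatorNorm.
Variables (W : set X) (n : nat).
Hypotheses (hW : closed_subspace W) (UVW : U `&` V `<=` W).
Hypothesis PWFix : forall x, P W (PFix x) = PUV x.
Local Notation N := (opnorm (fun y => P W (iter n (T U V) y) - PUV y)).

Let N_ub x : `|x| <= 1 -> `|P W (iter n (T U V) x) - PUV x| <= cF U V ^+ n.
Proof.
move=> x1; apply: le_trans (norm_oproj_iter_dr _ hW (PWFix x)) _.
apply: le_trans (norm_iter_dr_sub_oproj _ _) _.
by rewrite ler_piMr ?exprn_ge0 ?friedrichs_ge0.
Qed.

Lemma opnorm_le : N <= cF U V ^+ n.
Proof.
apply: ge_sup => [|_ [y y1 <-]]; last exact: N_ub.
by apply: image_nonempty; exists 0; rewrite /= normr0.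
Qed.

Lemma le_opnorm y : `|y| <= 1 -> `|P W (iter n (T U V) y) - PUV y| <= N.
Proof.
move=> y1; apply: ub_le_sup; last by exists y.
by exists (cF U V ^+ n) => _ [x x1 <-]; exact: N_ub.
Qed.

(** Let y be the n-th adjoint iterate of [w] and z = y/|y|: pairing the image of z with [w] gives
    <z, y> = |y|. *)
Lemma norm_iter_adjoint_le_opnorm w : W w -> (U `&` V)^_|_ w -> `|w| <= 1 ->
  `|iter n (T V U) w| <= N.
Proof.
move=> Ww wUV w1; set y := iter n (T V U) w.
have [->|y0] := eqVneq y 0.
  by rewrite normr0; apply: le_trans (le_opnorm (y := 0) _); rewrite ?normr0.
have z1 : `| `|y|^-1 *: y| <= 1.
  by rewrite normrZ normfV normr_id mulVf ?normr_eq0.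
apply: le_trans (le_opnorm z1); set z := _ *: y.
have -> : `|y| = '[P W (iter n (T U V) z) - PUV z, w].
  rewrite ipBl (oproj_ip hW) // (ipC (PUV z)) wUV ?subr0; last exact: oproj_in.
  rewrite iter_dr_adjoint // -/y ipZl -sqr_norm_ip expr2 mulKf //.
  by rewrite normr_eq0.
by apply: le_trans (ip_le_norm _ _) _; rewrite ler_piMr.
Qed.

(** The second hypothesis supplies, for each pair in the definition of the angle, a test vector [w]
    whose adjoint image has norm at least <u, v>. *)
Lemma friedrichs_le_opnorm : (n = 0%N -> exists2 w, W w & ~ (U `&` V) w) ->
  (forall u v, U u -> V v -> `|u| <= 1 -> `|v| <= 1 ->
     (U `&` V)^_|_ u -> (U `&` V)^_|_ v ->
     exists w, [/\ W w, (U `&` V)^_|_ w, `|w| <= 1 & '[u, v] <= `|T V U w|]) ->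
  N = cF U V ^+ n.
Proof.
move=> n0 ipT; apply/eqP; rewrite eq_le opnorm_le /=.
have N0 : 0 <= N by apply: le_trans (le_opnorm (y := 0) _); rewrite ?normr0.
move: n0 N0 norm_iter_adjoint_le_opnorm.
(* For n = 0 the value 1 is attained at the normalized component of [w] orthogonal to the
   intersection. *)
case: n => [/(_ erefl) [w Ww nw] _ hN|k _ N0 hN].
  set v := w - PUV w; have v0 : v != 0.
    apply/eqP => /subr0_eq wE; apply: nw; rewrite wE; exact: oproj_in.
  have v1 : `| `|v|^-1 *: v| = 1.
    by rewrite normrZ normfV normr_id mulVf ?normr_eq0.
  rewrite expr0 -v1; apply: hN; last by rewrite v1.
    by apply/(subspaceZ hW)/(subspaceB hW) => //; apply/UVW/(oproj_in hUV).
  by move=> y UVy; rewrite ipZl ipBl (oproj_ip hUV) // subrr mulr0.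
(* With S the adjoint, <u, v>^(k+1) <= |S w|^(k+1) <= |S^(k+1) w| <= N. *)
apply: friedrichs_exp_le => // u v Uu uUV Vv vUV u1 v1 uv0.
have [w [Ww wUV w1 uvw]] := ipT u v Uu Vv u1 v1 uUV vUV.
apply: le_trans (hN _ Ww wUV w1); apply: le_trans (norm_iter_dr_ge hU hV k w1).
by rewrite lerXn2r ?nnegrE.
Qed.

End OperatorNorm.
(** For n = 0 and [U] inside [V] the left side would be 0, against c^0 = 1. *)
Lemma opnorm_oprojl n : (n = 0%N -> ~ U `<=` V) ->
  opnorm (fun y => P U (iter n (T U V) y) - PUV y) = cF U V ^+ n.
Proof.
move=> n0; apply: friedrichs_le_opnorm => //.
- by move=> y; case: (oproj_fixed y).
- by move=> /n0/nonsubset[w [Uw nVw]]; exists w => // -[].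
(* The test vector is [u]: by normality |T V U u| = |T U V u| = |P V u| >= <u, v>. *)
move=> u v Uu Vv u1 v1 uUV _; exists u; split=> //.
by rewrite -norm_dr_sym // norm_dr_in // ip_le_norm_oproj.
Qed.

Lemma opnorm_oprojr n : (n = 0%N -> ~ V `<=` U) ->
  opnorm (fun y => P V (iter n (T U V) y) - PUV y) = cF U V ^+ n.
Proof.
move=> n0; apply: friedrichs_le_opnorm => //.
- by move=> y; case: (oproj_fixed y).
- by move=> /n0/nonsubset[w [Vw nUw]]; exists w => // -[].
move=> u v Uu Vv u1 v1 _ vUV; exists v; split=> //.
by rewrite norm_dr_in // ipC ip_le_norm_oproj.
Qed.

End Iterates.
End Hilbert.

(** * Convergence rates *)

Theorem theorem4p3 (R : realType) (X : completeNormedModType R)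
    (ip : {dot X for idfun}) (ip_norm : induces_norm ip)
    (U V : set X) (clU : closed_subspace U) (clV : closed_subspace V)
    (n : nat) (x : X) :
  let T := douglas_rachford ip U V in
  let PU := oproj ip U in
  let PV := oproj ip V in
  let PUV := oproj ip (U `&` V) in
  let PFix := oproj ip (fixed_points T) in
  let c := friedrichs_cos ip U V in
  [/\ (* for n = 0, the degenerate cases where U and V are nested, in which
         the equalities fail, are excluded *)
      ((n = 0)%N -> ~ U `<=` V /\ ~ V `<=` U) ->
        opnorm (fun y : X => PU (iter n T y) - PUV y) =
          opnorm (fun y : X => PV (iter n T y) - PUV y) /\
        opnorm (fun y : X => PV (iter n T y) - PUV y) = c ^+ n,
      Num.max `|PU (iter n T x) - PUV x| `|PV (iter n T x) - PUV x|
        <= c ^+ n * `|x| &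
      [/\ `|PV (iter n.+1 T x) - PUV x| <= c * `|PU (iter n T x) - PUV x|,
          c * `|PU (iter n T x) - PUV x| <= c * `|iter n T x - PFix x| &
          c * `|iter n T x - PFix x| <= c ^+ n.+1 * `|x| ] ].
Proof.
move=> T PU PV PUV PFix c.
have c0 : 0 <= c by exact: friedrichs_ge0.
have PWle W : closed_subspace W -> oproj ip W (PFix x) = PUV x ->
    `|oproj ip W (iter n T x) - PUV x| <= c ^+ n * `|x|.
  move=> hW WFix; apply: le_trans (norm_iter_dr_sub_oproj ip_norm clU clV n x).
  exact: norm_oproj_iter_dr.
have [PUFix PVFix] := oproj_fixed ip_norm clU clV x.
split.
- move=> n0.
  rewrite (opnorm_oprojl ip_norm clU clV); last by case/n0.
  by rewrite (opnorm_oprojr ip_norm clU clV) //; case/n0.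
- by rewrite ge_max !PWle.
split.
- exact: norm_oproj_iter_drS.
- by rewrite ler_wpM2l //; exact: norm_oproj_iter_dr.
by rewrite exprS -mulrA ler_wpM2l //; exact: norm_iter_dr_sub_oproj.
Qed.
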